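(* Let $G$ be a graph on $n \geq 4$ vertices, and let $t \geq 1$ be an integer such that \[ \binom{t+1}{2} + 3 \leq n \leq \binom{t+2}{2} + 2. \] Then $f(G) \leq t$, and this is sharp for all values of $n$ in the range; that is, for every integer $n$ in this range there is a graph $G$ on $n$ vertices with $f(G) = t$. Also, for every graph $G$ on $n \geq 4$ vertices, \[ f(G) \leq \left\lceil \frac{-3 + \sqrt{8n - 15}}{2} \right\rceil. \]
   Context: All graphs are finite and simple. For a graph $G$, $f(G) = f_2(G)$ denotes the minimum number of vertices that must be deleted from $G$ to obtain an induced subgraph $H$ in which at least two vertices have degree $\Delta(H)$ (the maximum degree of $H$), or otherwise $|H| < 2$, where $|H|$ is the number of vertices of $H$. *)

(* Defs.v *)
From HB Require Import structures.
From mathcomp Require Import all_boot all_order all_algebra.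
From mathcomp Require Import reals.

Set Implicit Arguments.
Unset Strict Implicit.
Unset Printing Implicit Defensive.

Record sgraph := SGraph {
  vertex :> finType;
  adj : rel vertex;
  adj_sym : symmetric adj;
  adj_irrefl : irreflexive adj }.

Definition deg (G : sgraph) (x : G) : nat := #|[set y : G | adj x y]|.

Definition maxdeg (G : sgraph) : nat := \max_(x : G) deg x.

Section Induced.
Variables (G : sgraph) (S : {set G}).

Definition induced_adj : rel {x : G | x \in S} :=
  fun x y => adj (val x) (val y).

Lemma induced_adj_sym : symmetric induced_adj.
Proof. by move=> x y; apply: adj_sym. Qed.

Lemma induced_adj_irrefl : irreflexive induced_adj.
Proof. by move=> x; apply: adj_irrefl. Qed.

Definition induced : sgraph := SGraph induced_adj_sym induced_adj_irrefl.

End Induced.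

Definition two_maxdeg (H : sgraph) : bool :=
  (2 <= #|[set x : H | deg x == maxdeg H]|) || (#|H| < 2).

(* [D] is the set of deleted vertices. The default [setT] is admissible, since
   deleting every vertex leaves the empty graph, so this is a true minimum. *)
Definition f2 (G : sgraph) : nat :=
  #|[arg min_(D < [set: G] | two_maxdeg (induced (~: D))) #|D|]|.

Lemma f2_spec (G : sgraph) :
  (exists2 D : {set G}, two_maxdeg (induced (~: D)) & #|D| = f2 G) /\
  (forall D : {set G}, two_maxdeg (induced (~: D)) -> f2 G <= #|D|).
Proof.
rewrite /f2; case: arg_minnP => [|D HD Dmin]; last by split; first exists D.
by apply/orP; right; rewrite card_sig eq_card0 // => x; rewrite !inE.
Qed.

(* Main.v *)
Require Import Defs.
From HB Require Import structures.
From mathcomp Require Import all_boot all_order all_algebra.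
From mathcomp Require Import reals.
From mathcomp Require Import zify lra.

Import Order.TTheory GRing.Theory Num.Theory.

(** Everything rests on a recursive description of the graphs with
    [k.+1 <= f2 G]: [G] has at least two vertices, among them a vertex [v]
    whose degree exceeds all other degrees by at least [k.+1], and
    [k <= f2 (G - v)].

    One direction ([resists_unique_max]) holds because the gap between the two
    largest degrees can always be closed by deleting that many vertices: delete
    private neighbours of the top vertex [v], that is, neighbours of [v] which
    are not neighbours of the runner-up [u].  The other direction
    ([resists_step]) holds because one deletion lowers a degree by at most one,
    so that [k] deletions sparing [v] leave [v] alone at the top, while a
    deletion set containing [v] leaves only [k.-1] deletions for [G - v].

    Upper bound.  Suppose [t.+1 <= f2 G] and remove the top vertices one after
    the other.  The gaps are at least [t.+1], [t], ..., [1], and the last top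
    vertex has degree at least 2, since its neighbours have degree at least 1.
    Summing up, the maximum degree is at least [1 + 2 + ... + t.+1 + 1], which
    is ['C(t.+2, 2) + 1].  This only gives [#|G| >= 'C(t.+2, 2) + 2]; the one
    missing vertex comes from looking at the top vertex [v] of [G] and the top
    vertex [u] of [G - v]: either [u] is not adjacent to [v], and then [v] and
    [u] both lie outside the neighbourhood of [v], or it is, and then the degree
    of [u] in [G] is one more than its degree in [G - v] ([card_of_resists]).

    Sharpness.  Reading the recursion backwards, one needs hubs [1 .. t.-1] whose
    degrees drop so slowly that each one dominates what follows it by the
    required gap.  They are made pairwise non-adjacent with nested neighbourhoods
    of sizes ['C(t.+1 - i, 2) + 1] among the remaining vertices, and a vertex [0]
    adjacent to everything is added.  Having [n] larger than necessary only adds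
    vertices whose sole neighbour is [0], so a single family serves the whole
    range of [n].

    The closed formula follows from [n >= 'C(t.+1, 2) + 3], which forces
    [8 * n - 15 > (2 * t + 1) ^ 2]. *)

Set Implicit Arguments.
Unset Strict Implicit.
Unset Printing Implicit Defensive.

(** * Balanced vertex sets *)

Definition degin (G : sgraph) (S : {set G}) (x : G) : nat :=
  #|[set y in S | adj x y]|.

(** The property asked of the remaining graph, phrased for a vertex set of the
    ambient graph.  Successive deletions then stay inside one type instead of
    producing induced subgraphs of induced subgraphs. *)
Definition balanced (G : sgraph) (S : {set G}) : Prop :=
  #|S| < 2 \/
  exists x y, [/\ x \in S, y \in S, x != y,
    forall z, z \in S -> degin S z <= degin S x &
    forall z, z \in S -> degin S z <= degin S y].

Definition resists (G : sgraph) (k : nat) (S : {set G}) : Prop :=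
  forall D : {set G}, #|D| < k -> ~ balanced (S :\: D).

Lemma deg_induced (G : sgraph) (S : {set G}) (x : induced S) :
  deg x = degin S (val x).
Proof.
rewrite /deg /degin -(card_imset _ val_inj); apply: eq_card => y.
rewrite !inE; apply/imsetP/andP => [[z]|[yS xy]].
  by rewrite inE => xz ->; split; first exact: (valP z).
by exists (exist _ y yS); rewrite ?inE.
Qed.

Lemma two_maxdeg_induced (G : sgraph) (S : {set G}) :
  two_maxdeg (induced S) <-> balanced S.
Proof.
have cardS : #|induced S| = #|S|.
  by rewrite card_sig; apply: eq_card => x; rewrite !inE.
rewrite /two_maxdeg cardS; split.
  case/orP=> [/card_gt1P[x [y []]]|]; last by left.
  rewrite !inE => /eqP dx /eqP dy xy; right; exists (val x), (val y).
  have le_max z (zS : z \in S) : degin S z <= maxdeg (induced S).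
    have := @leq_bigmax (induced S) (@deg _) (exist _ z zS).
    by rewrite deg_induced.
  split; [exact: valP|exact: valP| by rewrite (inj_eq val_inj)| |].
    by move=> z zS; rewrite -deg_induced dx le_max.
  by move=> z zS; rewrite -deg_induced dy le_max.
case=> [->|[x [y [xS yS xy xmax ymax]]]]; first by rewrite orbT.
apply/orP; left; apply/card_gt1P.
have is_max z (zS : z \in S) : (forall w, w \in S -> degin S w <= degin S z) ->
    (exist _ z zS : induced S) \in [set x : induced S | deg x == maxdeg (induced S)].
  move=> zmax; rewrite inE eqn_leq leq_bigmax /=.
  by apply/bigmax_leqP => w _; rewrite !deg_induced zmax //; apply: valP.
exists (exist _ x xS), (exist _ y yS); split; [exact: is_max|exact: is_max|].
by rewrite -(inj_eq val_inj).
Qed.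

Lemma leq_f2 (G : sgraph) (k : nat) : k <= f2 G <-> resists k [set: G].
Proof.
have [[D0 D0P <-] D0min] := f2_spec G; split=> [kD D Dk bal|res].
  have /D0min : two_maxdeg (induced (~: D)).
    by apply/two_maxdeg_induced; rewrite -setTD.
  by rewrite leqNgt (leq_trans Dk kD).
rewrite leqNgt; apply/negP => /res; apply.
by rewrite setTD; apply/two_maxdeg_induced.
Qed.

(** * Closing the gap between the two largest degrees *)

Lemma degin_sub (G : sgraph) (S T : {set G}) (x : G) :
  S \subset T -> degin S x <= degin T x.
Proof.
move=> /subsetP ST; apply/subset_leq_card/subsetP => y.
by rewrite !inE => /andP[/ST-> ->].
Qed.

Lemma degin_setD (G : sgraph) (S D : {set G}) (x : G) :
  degin S x <= degin (S :\: D) x + #|D|.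
Proof.
apply: leq_trans (leq_card_setU _ _); apply/subset_leq_card/subsetP => y.
by rewrite !inE => /andP[-> ->]; case: (y \in D).
Qed.

Lemma degin_setD1 (G : sgraph) (S : {set G}) (v x : G) : v \in S ->
  degin S x = adj x v + degin (S :\ v) x.
Proof.
move=> vS; rewrite /degin (cardsD1 v) !inE vS /=; congr (_ + _).
by apply: eq_card => y; rewrite !inE andbA.
Qed.

Lemma exists_max_degin (G : sgraph) (S : {set G}) (x0 : G) : x0 \in S ->
  exists2 v, v \in S & forall w, w \in S -> degin S w <= degin S v.
Proof. by move=> x0S; case: (@arg_maxnP _ x0 (mem S) (degin S) x0S) => v; exists v. Qed.

Lemma exists_subset_card (T : finType) (A : {set T}) (k : nat) :
  k <= #|A| -> exists2 B : {set T}, B \subset A & #|B| = k.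
Proof.
move=> /card_geqP[s [us <- sA]]; exists [set x in s]; last by rewrite cardsE; apply/card_uniqP.
by apply/subsetP => x; rewrite inE => /sA.
Qed.

(** The private neighbours of [v] outnumber those of [u] by the difference of
    the two degrees, so there are enough of them to delete.  Deleting them leaves
    the degree of [u] unchanged and lowers that of [v] to it; no other degree can
    overtake since deletions never increase a degree. *)
Lemma balance_top_two (G : sgraph) (S : {set G}) (v u : G) :
  v \in S -> u \in S -> u != v ->
  (forall w, w \in S -> degin S w <= degin S v) ->
  (forall w, w \in S :\ v -> degin S w <= degin S u) ->
  exists2 D : {set G}, #|D| = degin S v - degin S u & balanced (S :\: D).
Proof.
move=> vS uS uv vmax umax.
set P := [set y in S | adj v y && ~~ adj u y] :\ u.
(* The adjacency of u and v contributes equally to both degrees, so comparing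
   degrees after discarding this edge accounts for u being excluded from P. *)
have PE : degin S v <= degin S u + #|P|.
  rewrite (degin_setD1 v uS) (degin_setD1 u vS) adj_sym -addnA leq_add2l.
  apply: leq_trans (leq_card_setU _ _); apply/subset_leq_card/subsetP => y.
  rewrite !inE => /andP[/andP[-> ->]] vy; rewrite vy /=.
  by case: eqP vy => [->|_]; rewrite ?adj_irrefl //=; case: (adj u y).
have [|D DP cD] := @exists_subset_card _ P (degin S v - degin S u).
  by rewrite leq_subLR.
have inD y : y \in D -> [/\ y \in S, y != u, adj v y & ~~ adj u y].
  by move=> /(subsetP DP); rewrite !inE => /andP[-> /and3P[-> -> ->]].
exists D => //; right; exists v, u.
have vD : v \notin D by apply/negP => /inD[_ _]; rewrite adj_irrefl.
have uD : u \notin D by apply/negP => /inD[_]; rewrite eqxx.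
have degu : degin (S :\: D) u = degin S u.
  apply: eq_card => y; rewrite !inE; case: (boolP (y \in D)) => //= /inD[_ _ _].
  by move=> /negPf->; rewrite andbF.
have degv : degin (S :\: D) v = degin S u.
  have := vmax _ uS; suff : degin (S :\: D) v + #|D| = degin S v by lia.
  rewrite /degin; set N := [set y in S | _].
  have -> : [set y in S :\: D | adj v y] = N :\: D.
    by apply/setP => y; rewrite !inE andbA.
  have DN : D \subset N by apply/subsetP => y /inD[]; rewrite inE => -> _ ->.
  by rewrite cardsD (setIidPr DN) subnK // subset_leq_card.
have le_u z : z \in S :\: D -> degin (S :\: D) z <= degin S u.
  move=> zSD; case: (eqVneq z v) => [->|zv]; first by rewrite degv.
  apply: leq_trans (degin_sub z (subsetDl S D)) _.
  by apply: umax; rewrite !inE zv; move: zSD; rewrite inE => /andP[].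
by split; rewrite ?degv ?degu // ?inE ?vD ?uD // eq_sym.
Qed.

(** A gap of at most [k] could be closed by [k] deletions; and [k] deletions that
    balance [S :\ v], together with the deletion of [v], balance [S]. *)
Lemma resists_unique_max (G : sgraph) (k : nat) (S : {set G}) :
  resists k.+1 S ->
  exists v, [/\ v \in S, exists u, u \in S :\ v,
    forall w, w \in S :\ v -> degin S w + k.+1 <= degin S v &
    resists k (S :\ v)].
Proof.
move=> res.
have S2 : 1 < #|S|.
  rewrite ltnNge; apply/negP => S1; apply: (res set0); rewrite ?cards0 //.
  by left; rewrite setD0.
have [x xS] : exists x, x \in S by apply/card_gt0P; exact: ltn_trans S2.
have [v vS vmax] := exists_max_degin xS.
have Sv0 : exists u, u \in S :\ v.
  by apply/card_gt0P; move: S2; rewrite (cardsD1 v S) vS.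
exists v; split => //; last first.
  move=> D Dk; rewrite setDDl; apply: res.
  by rewrite cardsU1; case: (v \notin D); lia.
have [y ySv] := Sv0.
have Sdeg u : u \in S :\ v -> (forall w, w \in S :\ v -> degin S w <= degin S u) ->
    degin S u + k.+1 <= degin S v.
  rewrite !inE => /andP[uv uS] umax; rewrite leqNgt; apply/negP => small.
  have [D cD bal] := balance_top_two vS uS uv vmax umax.
  by apply: res bal; rewrite cD; lia.
case: (@arg_maxnP _ y (mem (S :\ v)) (degin S) ySv) => u uSv umax w wSv.
by apply: leq_trans (Sdeg u uSv umax); rewrite leq_add2r; exact: umax.
Qed.

(** * The upper bound *)

(** Summation of the gaps met when the top vertices are removed one by one. *)
Lemma resists_max_degin (G : sgraph) (k : nat) (S : {set G}) :
  resists k.+1 S -> exists2 v, v \in S & 'C(k.+2, 2) + 1 <= degin S v.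
Proof.
elim: k S => [|k IH] S /resists_unique_max[v [vS [u uSv] gap res]]; exists v => //.
  (* The top vertex has a neighbour y, of degree at least 1 and below the top,
     which gives degree at least 2. *)
  have /card_gt0P[y] : 0 < degin S v by have := gap u uSv; lia.
  rewrite inE => /andP[yS vy].
  have yv : y != v by apply: contraTneq vy => ->; rewrite adj_irrefl.
  have : 0 < degin S y by apply/card_gt0P; exists v; rewrite inE vS adj_sym.
  by have := gap y; rewrite !inE yv yS binn => /(_ isT); lia.
have [w wSv wdeg] := IH _ res.
have := gap w wSv; have := degin_sub w (subsetDl S [set v]).
by rewrite binS bin1; lia.
Qed.

(** Compared with [resists_max_degin] one extra vertex is gained, by way of the
    runner-up [u] obtained from [S :\ v]: if [u] is adjacent to [v] the gap is
    counted from a degree larger by one, and otherwise [u] joins [v] outside the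
    neighbourhood of [v].  A positive [t] guarantees that such a [u] of large
    degree exists; the path with three vertices is the exception for [t = 0]. *)
Lemma card_of_resists (G : sgraph) (t : nat) :
  0 < t -> resists t.+1 [set: G] -> 'C(t.+2, 2) + 3 <= #|G|.
Proof.
case: t => // k _ /resists_unique_max[v [vS _ gap res]].
have [u uSv udeg] := resists_max_degin res.
have := gap u uSv; rewrite (degin_setD1 u vS) adj_sym => gapu.
have uv : u != v by move: uSv; rewrite !inE andbT.
have : degin [set: G] v + 1 + ~~ adj v u <= #|G|.
  rewrite -cardsT (cardsD1 v) inE (cardsD1 u) uSv /degin (cardsD1 u) !inE /=.
  set N := [set y | _] :\ u; have : #|N| <= #|[set: G] :\ v :\ u|.
    apply/subset_leq_card/subsetP => y; rewrite !inE andbT => /andP[-> /= vy].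
    by apply: contraTneq vy => ->; rewrite adj_irrefl.
  by case: (adj v u); lia.
by rewrite binS bin1; case: (adj v u) gapu; lia.
Qed.

Lemma f2_upper (G : sgraph) (t : nat) :
  0 < t -> #|G| <= 'C(t.+2, 2) + 2 -> f2 G <= t.
Proof.
move=> t0 nG; rewrite leqNgt; apply/negP => /leq_f2 /(card_of_resists t0); lia.
Qed.

(** * Sharpness *)

(** Fewer than [k.+1] deletions cannot close a gap of [k.+1].  The hypothesis
    on the degree of [v] ensures that a neighbour of [v] survives, so that the
    remaining set is not balanced merely by having fewer than two vertices. *)
Lemma resists_step (G : sgraph) (k : nat) (S : {set G}) (v : G) :
  v \in S -> k < degin S v ->
  (forall w, w \in S :\ v -> degin S w + k.+1 <= degin S v) ->
  resists k (S :\ v) -> resists k.+1 S.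
Proof.
move=> vS dv gap res D Dk bal.
case: (boolP (v \in D)) => vD.
  apply: (res (D :\ v)); first by move: Dk; rewrite (cardsD1 v D) vD.
  by rewrite setDDl setD1K.
have vSD : v \in S :\: D by rewrite inE vD.
have unique w : w \in S :\: D -> w != v -> degin (S :\: D) w < degin (S :\: D) v.
  rewrite inE => /andP[_ wS] wv; have := gap w; rewrite !inE wv wS => /(_ isT).
  by have := degin_setD S D v; have := degin_sub w (subsetDl S D); lia.
case: bal => [|[x [y [xS yS xy xmax ymax]]]].
  have /card_gt0P[y] : 0 < degin (S :\: D) v by have := degin_setD S D v; lia.
  rewrite inE => /andP[ySD vy]; rewrite ltnNge => /negP; apply; apply/card_gt1P.
  by exists v, y; split => //; apply: contraTneq vy => ->; rewrite adj_irrefl.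
have [xv|xv] := eqVneq x v; last by have := unique x xS xv; have := xmax _ vSD; lia.
have yv : y != v by rewrite -xv eq_sym.
by have := unique y yS yv; have := ymax _ vSD; lia.
Qed.

Section Extremal.

Variables n t : nat.

(** Vertex [0] dominates, vertices [1 .. t.-1] are the hubs, and hub [i] sees an
    initial segment of the vertices from [t] on. *)
Definition hub_edge (i j : nat) : bool :=
  if i == 0 then j != 0 else (i < t <= j) && (j < t + ('C(t.+1 - i, 2) + 1)).

Definition extremal_adj : rel 'I_n := fun x y => hub_edge x y || hub_edge y x.

Lemma extremal_adj_sym : symmetric extremal_adj.
Proof. by move=> x y; rewrite /extremal_adj orbC. Qed.

Lemma extremal_adj_irrefl : irreflexive extremal_adj.
Proof.
move=> x; rewrite /extremal_adj orbb /hub_edge; case: ifP => [->//|_].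
by apply/negP; lia.
Qed.

Definition extremal : sgraph := SGraph extremal_adj_sym extremal_adj_irrefl.

Lemma card_interval (a b : nat) : b <= n ->
  #|[set y : 'I_n | a <= y < b]| = b - a.
Proof.
move=> bn; rewrite -sum1dep_card -(big_mkord (fun k => a <= k < b) (fun=> 1)).
under eq_bigl => k do rewrite andbC.
rewrite -[b - a]muln1 -sum_nat_const_nat (big_nat_widenl a 0) //.
by rewrite (big_nat_widen 0 b n) //; apply: eq_bigl => k; rewrite andbC.
Qed.

(** What remains once the first [i] top vertices have been removed. *)
Definition suffix (i : nat) : {set extremal} := [set x : 'I_n | i <= x].

Lemma suffixD1 (v : extremal) (i : nat) : v = i :> nat -> suffix i :\ v = suffix i.+1.
Proof.
by move=> vi; apply/setP => x; rewrite !inE -(inj_eq val_inj) /= vi ltn_neqAle eq_sym.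
Qed.

Hypothesis t_gt0 : 0 < t.
Hypothesis n_large : 'C(t.+1, 2) + 3 <= n.

Lemma degin_dominating (v : extremal) : v = 0 :> nat -> degin (suffix 0) v = n.-1.
Proof.
move=> v0; rewrite -subn1 -(@card_interval 1 n) //; apply: eq_card => y.
rewrite !inE /= /extremal_adj /hub_edge v0 /= ltn_ord andbT lt0n; case: eqP; lia.
Qed.

(** A vertex from [t] on only sees the dominating vertex and hubs, and just
    [t - i] of these are left. *)
Lemma degin_leaf (i : nat) (x : extremal) : t <= x -> degin (suffix i) x <= t - i.
Proof.
move=> tx; rewrite -(@card_interval i t); last first.
  by move: n_large; rewrite binS bin1; lia.
apply/subset_leq_card/subsetP => y; rewrite !inE /= /extremal_adj /hub_edge.
case: (x =P 0 :> nat) => [|_]; first lia.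
by case: (y =P 0 :> nat) => [|_]; lia.
Qed.

Lemma degin_hub (i : nat) (x : extremal) : 0 < i -> i <= x < t ->
  degin (suffix i) x = 'C(t.+1 - x, 2) + 1.
Proof.
move=> i0 /andP[ix xt].
have bn : t + ('C(t.+1 - x, 2) + 1) <= n.
  have : 'C(t.+1 - x, 2) <= 'C(t, 2) by apply: leq_bin2l; lia.
  by move: n_large; rewrite binS bin1; lia.
rewrite -[RHS](addKn t) -(card_interval t bn); apply: eq_card => y.
rewrite !inE /= /extremal_adj /hub_edge.
case: (x =P 0 :> nat) => [|_]; first lia.
by case: (y =P 0 :> nat) => [|_]; lia.
Qed.

Lemma resists_suffix (k : nat) : k <= t -> resists k (suffix (t - k)).
Proof.
elim: k => [|k IH] kt; first by move=> D.
set i := t - k.+1; have it : i < t by lia.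
have i_n : i < n by move: n_large; rewrite binS bin1; lia.
pose v : extremal := Ordinal i_n.
have Sv : suffix i :\ v = suffix (t - k) by rewrite (suffixD1 (i := i)) //; congr suffix; lia.
have vS : v \in suffix i by rewrite inE.
(* This bounds the degrees of the vertices seen by the hubs. *)
have tri m : m <= 'C(m, 2) + 1 by case: m => // m; rewrite binS bin1; lia.
suff [dv gap] : k < degin (suffix i) v /\
    forall w, w \in suffix (t - k) -> degin (suffix i) w + k.+1 <= degin (suffix i) v.
  by apply: (resists_step vS); rewrite ?Sv //; apply: IH; lia.
have [i0|i_gt0] := posnP i.
  have kE : k.+1 = t by lia.
  have nE : 'C(t, 2) + t + 3 <= n by move: n_large; rewrite binS bin1.
  rewrite i0 in vS Sv *; rewrite degin_dominating //.
  split=> [|w]; first by lia.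
  rewrite inE => iw; have [wt|tw] := ltnP w t; last first.
    by have := degin_leaf 0 tw; have := tri t; lia.
  have := degin_setD1 w vS; rewrite (suffixD1 (i := 0)) //.
  rewrite [degin (suffix 1) w]degin_hub //; last by lia.
  have : 'C(t.+1 - w, 2) <= 'C(t, 2) by apply: leq_bin2l; lia.
  by case: (adj w v); lia.
have vE : degin (suffix i) v = 'C(k.+1, 2) + k.+1 + 1.
  have tiE : t.+1 - i = k.+2 by lia.
  by rewrite degin_hub ?leqnn //= tiE binS bin1.
rewrite vE; split=> [|w]; first by lia.
rewrite inE => iw; have [wt|tw] := ltnP w t; last first.
  by have := degin_leaf i tw; have := tri k.+1; lia.
rewrite degin_hub //; last by lia.
have : 'C(t.+1 - w, 2) <= 'C(k.+1, 2) by apply: leq_bin2l; lia.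
lia.
Qed.

Lemma f2_extremal : t <= f2 extremal.
Proof.
apply/leq_f2; have := resists_suffix (leqnn t); rewrite subnn.
by rewrite (_ : suffix 0 = [set: extremal]) //; apply/setP => x; rewrite !inE.
Qed.

End Extremal.

(** * The closed formula *)

(** The ranges for [t = 1, 2, ...] are consecutive and the first starts at 4. *)
Lemma exists_range (n : nat) : 4 <= n ->
  exists2 t, 0 < t & 'C(t.+1, 2) + 3 <= n <= 'C(t.+2, 2) + 2.
Proof.
move=> n4; have bounded : exists t, n <= 'C(t.+2, 2) + 2.
  by exists n; rewrite binS bin1; lia.
case: (ex_minnP bounded) => -[|t] nt tmin; first by move: nt; rewrite binn; lia.
exists t.+1 => //; rewrite nt andbT leqNgt; apply/negP => small.
by have := tmin t; lia.
Qed.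

Lemma leq_ceil_sqrt (R : realType) (n t : nat) : 'C(t.+1, 2) + 3 <= n ->
  (Posz t <= Num.ceil ((- 3 + Num.sqrt (8 * n%:R - 15 : R)) / 2))%R.
Proof.
move=> nt.
have n_sq : (t.*2.+1) ^ 2 + 15 < 8 * n.
  have := bin2 t.+1; have := mul_bin_diag t 1; rewrite bin1; nia.
have lt_sqrt : ((t.*2.+1)%:R < Num.sqrt (8 * n%:R - 15 : R))%R.
  rewrite -[ltLHS]gtr0_norm // -sqrtr_sqr ltr_sqrt.
    by rewrite ltrBrDr -natrX -!natrM -natrD ltr_nat.
  rewrite subr_gt0 -natrM ltr_nat; lia.
(* An integer t is at most the ceiling of x exactly when t - 1 < x. *)
have -> : Posz t = (Posz t - 1 + 1)%R by rewrite subrK.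
rewrite lezD1 ceil_gt_int rmorphB /= pmulrn ltr_pdivlMr //.
move: lt_sqrt; rewrite -mul2n -addn1 natrD natrM; lra.
Qed.

Theorem theorem2p6 (R : realType) :
  (forall n t : nat, 4 <= n -> 1 <= t ->
     'C(t.+1, 2) + 3 <= n <= 'C(t.+2, 2) + 2 ->
     (forall G : sgraph, #|G| = n -> f2 G <= t) /\
     (exists G : sgraph, #|G| = n /\ f2 G = t)) /\
  (forall (n : nat) (G : sgraph), 4 <= n -> #|G| = n ->
     (Posz (f2 G) <= Num.ceil ((- 3 + Num.sqrt (8 * n%:R - 15 : R)) / 2))%R).
Proof.
split=> [n t _ t0 /andP[tn nt]|n G n4 nG].
  have upper (G : sgraph) : #|G| = n -> f2 G <= t.
    by move=> nG; apply: f2_upper; rewrite ?nG.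
  have card_ext : #|extremal n t| = n by rewrite /= card_ord.
  split=> //; exists (extremal n t); split=> //; apply/eqP.
  by rewrite eqn_leq upper //= f2_extremal.
have [t t0 /andP[tn nt]] := exists_range n4.
apply: le_trans (leq_ceil_sqrt R tn).
by rewrite lez_nat f2_upper // nG.
Qed.
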